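(* Let $\mathcal{A}$ be a locally finite tensor Grothendieck category. Then $\mathcal{A}$ is tensor reduced, i.e. for every object $X\in\mathcal{A}$, $X\otimes X=0$ if and only if $X=0$.
   Context: Throughout, $\mathbb{k}$ is an algebraically closed field and all categories are $\mathbb{k}$-linear. A tensor category is a rigid monoidal abelian category $(\mathcal{C},\otimes,\mathbb{1})$ (every object has left and right duals) such that $\otimes$ is bilinear on morphisms and $\mathrm{End}_{\mathcal{C}}(\mathbb{1})\cong\mathbb{k}$. An abelian category is finite if every object has finite length and there are only finitely many isomorphism classes of simple objects. A finite tensor category is a tensor category whose underlying abelian category is finite. An object $A$ of a Grothendieck category $\mathcal{A}$ is finitely presented if $\mathrm{Hom}_{\mathcal{A}}(A,-)$ preserves filtered colimits; $\mathrm{fp}(\mathcal{A})$ is the full subcategory of finitely presented objects. $\mathcal{A}$ is locally finitely presented if $\mathrm{fp}(\mathcal{A})$ is skeletally small and every object is a filtered colimit of finitely presented objects; it is locally coherent if moreover $\mathrm{fp}(\mathcal{A})$ is abelian. A locally finite tensor Grothendieck category is a locally coherent Grothendieck category $\mathcal{A}$ such that $\mathrm{fp}(\mathcal{A})$ is a finite tensor category. In that case $\mathcal{A}$ is a monoidal abelian category with biexact tensor product commuting with filtered colimits in each variable: for $A\cong\varinjlim_{i\in I}A_i$ and $B\cong\varinjlim_{j\in J}B_j$ with $I,J$ filtered and $A_i,B_j\in\mathrm{fp}(\mathcal{A})$, one sets $A\otimes B:=\varinjlim_{i\in I}\varinjlim_{j\in J}A_i\otimes B_j$. *)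

(* Defs.v *)
From HB Require Import structures.
From mathcomp Require Import all_boot all_order all_algebra.
From mathcomp Require Import boolp.

Set Implicit Arguments.
Unset Strict Implicit.
Unset Printing Implicit Defensive.

Import GRing.Theory.
Local Open Scope ring_scope.

Declare Scope cat_scope.
Delimit Scope cat_scope with cat.
Local Open Scope cat_scope.

(* Small sets are the types in the universe of the carriers of MathComp's
   modules: Hom-sets, index sets of colimits and Hom-modules then all have
   the same size.  Objects of a category live in a strictly larger universe
   (the instance [SET] below forces this). *)
Notation smallType := Type@{GRing.Lmodule.axioms_.u0}.

Record category := Category {
  ob :> Type;
  Mor : ob -> ob -> smallType;
  idm : forall X, Mor X X;
  compm : forall X Y Z, Mor Y Z -> Mor X Y -> Mor X Z;
  comp1m : forall X Y (f : Mor X Y), compm (idm Y) f = f;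
  compm1 : forall X Y (f : Mor X Y), compm f (idm X) = f;
  compmA : forall X Y Z W (h : Mor Z W) (g : Mor Y Z) (f : Mor X Y),
    compm h (compm g f) = compm (compm h g) f
}.

Arguments Mor {c}.
Arguments idm {c}.
Notation "g ∘ f" := (compm g f) (at level 40, left associativity) : cat_scope.

Record small_category := SmallCategory {
  sob : smallType;
  sMor : sob -> sob -> smallType;
  sidm : forall i, sMor i i;
  scomp : forall i j k, sMor j k -> sMor i j -> sMor i k;
  scomp1m : forall i j (u : sMor i j), scomp (sidm j) u = u;
  scompm1 : forall i j (u : sMor i j), scomp u (sidm i) = u;
  scompA : forall i j k l (w : sMor k l) (v : sMor j k) (u : sMor i j),
    scomp w (scomp v u) = scomp (scomp w v) u
}.

Definition category_of_small (I : small_category) : category :=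
  Category (@scomp1m I) (@scompm1 I) (@scompA I).
Coercion category_of_small : small_category >-> category.

Record iso (C : category) (X Y : C) := Iso {
  iso_hom :> Mor X Y;
  iso_inv : Mor Y X;
  iso_invK : iso_inv ∘ iso_hom = idm X;
  iso_homK : iso_hom ∘ iso_inv = idm Y
}.

Definition isomorphic (C : category) (X Y : C) : Prop := inhabited (iso X Y).

Definition is_iso (C : category) (X Y : C) (f : Mor X Y) : Prop :=
  exists g : Mor Y X, g ∘ f = idm X /\ f ∘ g = idm Y.

Definition mono (C : category) (X Y : C) (f : Mor X Y) : Prop :=
  forall W (g h : Mor W X), f ∘ g = f ∘ h -> g = h.

Definition epi (C : category) (X Y : C) (f : Mor X Y) : Prop :=
  forall Z (g h : Mor Y Z), g ∘ f = h ∘ f -> g = h.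

Record functor (C D : category) := Functor {
  fob :> C -> D;
  fmap : forall X Y, Mor X Y -> Mor (fob X) (fob Y);
  fmap1 : forall X, fmap (idm X) = idm (fob X);
  fmapM : forall X Y Z (g : Mor Y Z) (f : Mor X Y),
    fmap (g ∘ f) = fmap g ∘ fmap f
}.
Arguments fmap {C D} f {X Y} : rename.

Record nattrans (C D : category) (F G : functor C D) := NatTrans {
  ntr :> forall X, Mor (F X) (G X);
  ntr_nat : forall X Y (f : Mor X Y), ntr Y ∘ fmap F f = fmap G f ∘ ntr X
}.

Section CompFunctor.
Variables (C D E : category) (G : functor D E) (F : functor C D).
Fact comp_fmap1 X : fmap G (fmap F (idm X)) = idm (G (F X)).
Proof. by rewrite !fmap1. Qed.
Fact comp_fmapM X Y Z (g : Mor Y Z) (f : Mor X Y) :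
  fmap G (fmap F (g ∘ f)) = fmap G (fmap F g) ∘ fmap G (fmap F f).
Proof. by rewrite !fmapM. Qed.
Definition comp_functor : functor C E := Functor comp_fmap1 comp_fmapM.
End CompFunctor.

Record cocone (I C : category) (D : functor I C) (L : C) := Cocone {
  leg :> forall i, Mor (D i) L;
  leg_nat : forall i j (u : Mor i j), leg j ∘ fmap D u = leg i
}.

Definition is_colimit (I C : category) (D : functor I C) (L : C)
    (c : cocone D L) : Prop :=
  forall Y (d : cocone D Y), exists! h : Mor L Y, forall i, h ∘ c i = d i.

Record colimit (I C : category) (D : functor I C) := Colimit {
  col_ob :> C;
  col_cocone : cocone D col_ob;
  col_univ : is_colimit col_cocone
}.

Section MapCocone.
Variables (I C E : category) (F : functor C E) (D : functor I C).
Variables (L : C) (c : cocone D L).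
Fact map_cocone_nat i j (u : Mor i j) :
  fmap F (c j) ∘ fmap (comp_functor F D) u = fmap F (c i).
Proof. by rewrite /= -fmapM leg_nat. Qed.
Definition map_cocone : cocone (comp_functor F D) (F L) := Cocone map_cocone_nat.
End MapCocone.

Definition filtered (I : category) : Prop :=
  [/\ inhabited I,
      forall i j : I, exists k, inhabited (Mor i k) /\ inhabited (Mor j k) &
      forall (i j : I) (u v : Mor i j), exists k (w : Mor j k), w ∘ u = w ∘ v].

Definition cocomplete (C : category) : Prop :=
  forall (I : small_category) (D : functor I C), inhabited (colimit D).

Definition preserves_filtered_colimits (C E : category) (F : functor C E) : Prop :=
  forall (I : small_category) (D : functor I C) (L : C) (c : cocone D L),
    filtered I -> is_colimit c -> is_colimit (map_cocone F c).

Definition SET : category :=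
  @Category smallType (fun S T => S -> T) (fun _ => id)
    (fun _ _ _ g f x => g (f x))
    (fun _ _ _ => erefl) (fun _ _ _ => erefl) (fun _ _ _ _ _ _ _ => erefl).

Section HomFunctor.
Variables (C : category) (A : C).
Definition hom_map X Y (f : Mor X Y) : @Mor SET (Mor A X) (Mor A Y) :=
  fun g => f ∘ g.
Fact hom_map1 X : hom_map (idm X) = @idm SET (Mor A X).
Proof. by apply: funext => g; rewrite /hom_map comp1m. Qed.
Fact hom_mapM X Y Z (g : Mor Y Z) (f : Mor X Y) :
  hom_map (g ∘ f) = (hom_map g : @Mor SET _ _) ∘ hom_map f.
Proof. by apply: funext => h; rewrite /hom_map -compmA. Qed.
Definition hom_functor : functor C SET := @Functor C SET _ _ hom_map1 hom_mapM.
End HomFunctor.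

Definition finitely_presented (C : category) (A : C) : Prop :=
  preserves_filtered_colimits (hom_functor A).

Record linear_category (k : fieldType) := LinearCategory {
  lin_cat :> category;
  hom_module : forall X Y : lin_cat, GRing.Lmodule k (Mor X Y);
  hom_lmod := fun X Y => GRing.Lmodule.Pack (hom_module X Y);
  comp_linearl : forall (X Y Z : lin_cat) (a : k) (g g' : hom_lmod Y Z)
      (f : hom_lmod X Y),
    (a *: g + g') ∘ f = (a *: (g ∘ f : hom_lmod X Z) + g' ∘ f :> hom_lmod X Z);
  comp_linearr : forall (X Y Z : lin_cat) (a : k) (g : hom_lmod Y Z)
      (f f' : hom_lmod X Y),
    g ∘ (a *: f + f') = (a *: (g ∘ f : hom_lmod X Z) + g ∘ f' :> hom_lmod X Z)
}.

HB.instance Definition _ (k : fieldType) (C : linear_category k) (X Y : C) :=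
  GRing.Lmodule.copy (Mor X Y) (hom_lmod X Y).

Section FullSubcategory.
Variables (k : fieldType) (C : linear_category k) (P : C -> Prop).

Definition full_sub_category : category :=
  @Category {X : C | P X} (fun X Y => Mor (sval X) (sval Y))
    (fun X => idm (sval X)) (fun _ _ _ g f => g ∘ f)
    (fun _ _ => @comp1m C _ _) (fun _ _ => @compm1 C _ _)
    (fun _ _ _ _ => @compmA C _ _ _ _).

Definition full_sub : linear_category k :=
  @LinearCategory k full_sub_category
    (fun X Y => hom_module (sval X) (sval Y))
    (fun X Y Z => @comp_linearl k C (sval X) (sval Y) (sval Z))
    (fun X Y Z => @comp_linearr k C (sval X) (sval Y) (sval Z)).

Definition full_sub_incl : functor full_sub C :=
  @Functor full_sub C (fun X => sval X) (fun _ _ f => f)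
    (fun _ => erefl) (fun _ _ _ _ _ => erefl).
End FullSubcategory.

Section Abelian.
Variables (k : fieldType) (C : linear_category k).

Definition is_zero (X : C) : Prop :=
  (forall Y, exists! f : Mor X Y, True) /\ (forall Y, exists! f : Mor Y X, True).

Definition is_biproduct (X Y P : C) : Prop :=
  exists (i : Mor X P) (j : Mor Y P) (p : Mor P X) (q : Mor P Y),
    [/\ p ∘ i = idm X, q ∘ j = idm Y, q ∘ i = 0, p ∘ j = 0
      & i ∘ p + j ∘ q = idm P].

Definition is_kernel (X Y K : C) (f : Mor X Y) (i : Mor K X) : Prop :=
  f ∘ i = 0 /\
  forall W (g : Mor W X), f ∘ g = 0 -> exists! h : Mor W K, i ∘ h = g.

Definition is_cokernel (X Y Q : C) (f : Mor X Y) (p : Mor Y Q) : Prop :=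
  p ∘ f = 0 /\
  forall Z (g : Mor Y Z), g ∘ f = 0 -> exists! h : Mor Q Z, h ∘ p = g.

Record abelian : Prop := Abelian {
  ab_zero : exists Z : C, is_zero Z;
  ab_biproduct : forall X Y : C, exists P, is_biproduct X Y P;
  ab_kernel : forall (X Y : C) (f : Mor X Y),
    exists K (i : Mor K X), is_kernel f i;
  ab_cokernel : forall (X Y : C) (f : Mor X Y),
    exists Q (p : Mor Y Q), is_cokernel f p;
  ab_mono : forall (X Y : C) (f : Mor X Y),
    mono f -> exists Z (g : Mor Y Z), is_kernel g f;
  ab_epi : forall (X Y : C) (f : Mor X Y),
    epi f -> exists W (g : Mor W X), is_cokernel g f
}.

Definition short_exact (X Y Z : C) (f : Mor X Y) (g : Mor Y Z) : Prop :=
  is_kernel g f /\ is_cokernel f g.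

Definition simple (X : C) : Prop :=
  ~ is_zero X /\
  forall Y (i : Mor Y X), mono i -> is_zero Y \/ is_iso i.

Inductive finite_length : C -> Prop :=
| finite_length0 X : is_zero X -> finite_length X
| finite_lengthS X' X S (i : Mor X' X) (p : Mor X S) :
    short_exact i p -> simple S -> finite_length X' -> finite_length X.

Definition finite_abelian : Prop :=
  [/\ abelian, forall X : C, finite_length X &
      exists (n : nat) (S : 'I_n -> C),
        forall X : C, simple X -> exists i, isomorphic X (S i)].

Definition filtered_colimits_exact : Prop :=
  forall (I : small_category) (D1 D2 D3 : functor I C)
      (a : nattrans D1 D2) (b : nattrans D2 D3)
      (L1 L2 L3 : C) (c1 : cocone D1 L1) (c2 : cocone D2 L2) (c3 : cocone D3 L3)
      (f : Mor L1 L2) (g : Mor L2 L3),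
    filtered I -> (forall i, short_exact (a i) (b i)) ->
    is_colimit c1 -> is_colimit c2 -> is_colimit c3 ->
    (forall i, f ∘ c1 i = c2 i ∘ a i) -> (forall i, g ∘ c2 i = c3 i ∘ b i) ->
    short_exact f g.

Definition is_generator (G : C) : Prop :=
  forall (X Y : C) (f g : Mor X Y),
    (forall h : Mor G X, f ∘ h = g ∘ h) -> f = g.

Record grothendieck : Prop := Grothendieck {
  gr_abelian : abelian;
  gr_cocomplete : cocomplete C;
  gr_exact : filtered_colimits_exact;
  gr_generator : exists G : C, is_generator G
}.
End Abelian.

Section LocallyCoherent.
Variables (k : fieldType) (C : linear_category k).

Definition fp : linear_category k := full_sub (@finitely_presented C).
Definition fp_incl : functor fp C := full_sub_incl (@finitely_presented C).

Definition skeletally_small (E : category) : Prop :=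
  exists (S : smallType) (R : S -> E), forall X : E, exists s, isomorphic X (R s).

Record presentation (X : C) := Presentation {
  pr_index : small_category;
  pr_filtered : filtered pr_index;
  pr_diag : functor pr_index fp;
  pr_cocone : cocone (comp_functor fp_incl pr_diag) X;
  pr_univ : is_colimit pr_cocone
}.

Record locally_finitely_presented : Prop := LocallyFinitelyPresented {
  lfp_small : skeletally_small fp;
  lfp_presentation : forall X : C, inhabited (presentation X)
}.

Record locally_coherent : Prop := LocallyCoherent {
  lcoh_lfp : locally_finitely_presented;
  lcoh_abelian : abelian fp
}.

End LocallyCoherent.

Record monoidal (C : category) := Monoidal {
  tens : C -> C -> C;
  tensm : forall X X' Y Y',
    Mor X X' -> Mor Y Y' -> Mor (tens X Y) (tens X' Y');
  tensm1 : forall X Y, tensm (idm X) (idm Y) = idm (tens X Y);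
  tensmM : forall X X' X'' Y Y' Y'' (f' : Mor X' X'') (f : Mor X X')
      (g' : Mor Y' Y'') (g : Mor Y Y'),
    tensm (f' ∘ f) (g' ∘ g) = tensm f' g' ∘ tensm f g;
  tunit : C;
  tassoc : forall X Y Z, iso (tens (tens X Y) Z) (tens X (tens Y Z));
  tassoc_nat : forall X X' Y Y' Z Z' (f : Mor X X') (g : Mor Y Y') (h : Mor Z Z'),
    tassoc X' Y' Z' ∘ tensm (tensm f g) h = tensm f (tensm g h) ∘ tassoc X Y Z;
  tlunit : forall X, iso (tens tunit X) X;
  tlunit_nat : forall X X' (f : Mor X X'),
    tlunit X' ∘ tensm (idm tunit) f = f ∘ tlunit X;
  trunit : forall X, iso (tens X tunit) X;
  trunit_nat : forall X X' (f : Mor X X'),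
    trunit X' ∘ tensm f (idm tunit) = f ∘ trunit X;
  pentagon : forall W X Y Z,
    tassoc W X (tens Y Z) ∘ tassoc (tens W X) Y Z =
    tensm (idm W) (tassoc X Y Z) ∘ tassoc W (tens X Y) Z
      ∘ tensm (tassoc W X Y) (idm Z);
  triangle : forall X Y,
    tensm (idm X) (tlunit Y) ∘ tassoc X tunit Y = tensm (trunit X) (idm Y)
}.
Arguments tassoc {C} m.
Arguments tlunit {C} m.
Arguments trunit {C} m.

Section Dual.
Variables (C : category) (M : monoidal C).

(* [X'] is left dual to [X], equivalently [X] is right dual to [X']. *)
Definition is_dual (X' X : C) : Prop :=
  exists (ev : Mor (tens M X' X) (tunit M)) (coev : Mor (tunit M) (tens M X X')),
    trunit M X ∘ tensm M (idm X) ev ∘ tassoc M X X' X ∘ tensm M coev (idm X)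
      = tlunit M X /\
    tlunit M X' ∘ tensm M ev (idm X') ∘ iso_inv (tassoc M X' X X')
      ∘ tensm M (idm X') coev
      = trunit M X'.

Definition rigid : Prop :=
  forall X : C, (exists X', is_dual X' X) /\ (exists X', is_dual X X').
End Dual.

Section TensorCategory.
Variables (k : fieldType) (C : linear_category k) (M : monoidal C).

Definition tensor_bilinear : Prop :=
  forall X X' Y Y' : C,
    (forall (a : k) (f f' : Mor X X') (g : Mor Y Y'),
      tensm M (a *: f + f') g = a *: tensm M f g + tensm M f' g) /\
    (forall (a : k) (f : Mor X X') (g g' : Mor Y Y'),
      tensm M f (a *: g + g') = a *: tensm M f g + tensm M f g').

(* The only morphism of unital k-algebras k -> End(1) sends a to a *: id. *)
Definition end_unit_is_k : Prop :=
  bijective (fun a : k => a *: (idm (tunit M) : Mor _ _)).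

Record tensor_category : Prop := TensorCategory {
  tc_abelian : abelian C;
  tc_bilinear : tensor_bilinear;
  tc_rigid : rigid M;
  tc_unit : end_unit_is_k
}.

Definition finite_tensor_category : Prop := tensor_category /\ finite_abelian C.
End TensorCategory.

Record lft_grothendieck (k : fieldType) := LftGrothendieck {
  lft_cat :> linear_category k;
  lft_groth : grothendieck lft_cat;
  lft_coherent : locally_coherent lft_cat;
  lft_monoidal : monoidal (fp lft_cat);
  lft_tensor : finite_tensor_category lft_monoidal
}.

Section TensorFunctor.
Variables (C : category) (M : monoidal C) (X : C).
Definition tensl_map Y Y' (g : Mor Y Y') : Mor (tens M X Y) (tens M X Y') :=
  tensm M (idm X) g.
Fact tensl_map1 Y : tensl_map (idm Y) = idm (tens M X Y).
Proof. exact: tensm1. Qed.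
Fact tensl_mapM Y Y' Y'' (g : Mor Y' Y'') (f : Mor Y Y') :
  tensl_map (g ∘ f) = tensl_map g ∘ tensl_map f.
Proof. by rewrite /tensl_map -tensmM comp1m. Qed.
Definition tensl : functor C C := Functor tensl_map1 tensl_mapM.
End TensorFunctor.

Section ColimitMap.
Variables (I C : category) (D : functor I C) (L : colimit D) (Y : C).

Definition col_desc (d : cocone D Y) : Mor L Y := sval (cid (col_univ L d)).

Fact col_descE (d : cocone D Y) i : col_desc d ∘ col_cocone L i = d i.
Proof. by rewrite /col_desc; case: cid => h /= [hE _]; exact: hE. Qed.

Fact col_ext (f g : Mor L Y) :
  (forall i, f ∘ col_cocone L i = g ∘ col_cocone L i) -> f = g.
Proof.
move=> fg.
have gnat i j (u : Mor i j) :
    (g ∘ col_cocone L j) ∘ fmap D u = g ∘ col_cocone L i.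
  by rewrite -compmA leg_nat.
have [h [_ huniq]] := col_univ L (Cocone gnat).
by rewrite -(huniq f fg); exact: huniq.
Qed.
End ColimitMap.

Section Tensor.
Variables (k : fieldType) (A : lft_grothendieck k).

Definition colim (I : small_category) (D : functor I A) : colimit D :=
  inhabited_witness (gr_cocomplete (lft_groth A) D).

Definition pres (X : A) : presentation X :=
  inhabited_witness (lfp_presentation (lcoh_lfp (lft_coherent A)) X).

Section Presentations.
Variables (X Y : A) (P : presentation X) (Q : presentation Y).
Local Notation M := (lft_monoidal A).
Local Notation incl := (fp_incl A).

(* j |-> A_i ⊗ B_j *)
Definition inner_diag (i : pr_index P) : functor (pr_index Q) A :=
  comp_functor incl (comp_functor (tensl M (pr_diag P i)) (pr_diag Q)).

Definition outer_leg (i i' : pr_index P) (u : Mor i i') (j : pr_index Q) :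
    Mor (inner_diag i j) (colim (inner_diag i')) :=
  col_cocone (colim (inner_diag i')) j
    ∘ fmap incl (tensm M (fmap (pr_diag P) u) (idm (pr_diag Q j))).

Fact outer_leg_nat i i' (u : Mor i i') j j' (v : Mor j j') :
  outer_leg u j' ∘ fmap (inner_diag i) v = outer_leg u j.
Proof.
rewrite /outer_leg -(leg_nat (col_cocone (colim (inner_diag i'))) v).
rewrite -!compmA; congr (_ ∘ _).
rewrite [fmap (inner_diag i) v]/= [fmap (inner_diag i') v]/=.
rewrite -[LHS](@tensmM _ M) -[RHS](@tensmM _ M).
by rewrite !comp1m !compm1.
Qed.

Definition outer_map (i i' : pr_index P) (u : Mor i i') :
    Mor (colim (inner_diag i) : A) (colim (inner_diag i')) :=
  col_desc (colim (inner_diag i)) (Cocone (outer_leg_nat u)).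

Fact outer_map1 i : outer_map (idm i) = idm (colim (inner_diag i) : A).
Proof.
apply: col_ext => j; rewrite col_descE comp1m /= /outer_leg fmap1 tensm1.
exact: compm1.
Qed.

Fact outer_mapM i i' i'' (v : Mor i' i'') (u : Mor i i') :
  outer_map (v ∘ u) = outer_map v ∘ outer_map u.
Proof.
apply: col_ext => j; rewrite -compmA !col_descE /= {2}/outer_leg compmA.
rewrite col_descE /= /outer_leg fmapM -compmA; congr (_ ∘ _).
by rewrite -[RHS](@tensmM _ M) comp1m.
Qed.

(* i |-> colim_j A_i ⊗ B_j *)
Definition outer_diag : functor (pr_index P) A := Functor outer_map1 outer_mapM.

(* colim_i colim_j A_i ⊗ B_j *)
Definition tensor_along : A := colim outer_diag.
End Presentations.

(* [pres] chooses a presentation of each object; another choice gives an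
   isomorphic tensor product. *)
Definition tensor (X Y : A) : A := tensor_along (pres X) (pres Y).

Definition tensor_reduced : Prop :=
  forall X : A, is_zero (tensor X X) <-> is_zero X.

End Tensor.

(* Main.v *)
Require Import Defs.
From mathcomp Require Import all_boot all_algebra.
From mathcomp Require Import boolp.

Set Implicit Arguments.
Unset Strict Implicit.
Unset Printing Implicit Defensive.

Import GRing.Theory.
Local Open Scope ring_scope.
Local Open Scope cat_scope.

(** The theorem is reduced to a statement about morphisms of the tensor category
    of finitely presented objects: [f ⊗ f = 0] forces [f = 0]
    ([tens_square_eq0]).

    Write [X] as a filtered colimit of finitely presented [A_i].  A morphism
    from a finitely presented object that dies in a filtered colimit already
    dies at a finite stage ([fp_leg_eq0]).  If [X ⊗ X = 0], this applies to
    [A_i ⊗ A_i -> X ⊗ X], once for each of the two colimits defining the tensor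
    product, and yields a transition map [f] out of [A_i] with [f ⊗ f = 0]
    ([tensor_along_square_zero]).  Hence [f = 0], so [A_i -> X] is zero for each
    [i], so [X = 0].  The converse ([tensor_along_zero]) is the same remark
    applied to [A_i -> X].

    In a tensor category the unit is simple ([unit_mono]).  This uses
    [End(1) = k]: a simple subobject [S] of the unit satisfies
    [S ≅ S ⊗ S'], where [S'] is its dual, so coevaluation provides a nonzero
    map [1 -> S], and the resulting nonzero endomorphism of [1] is invertible.
    Consequently the name [1 -> B ⊗ A'] of a nonzero [f : A -> B] is mono.
    Tensoring with [B] keeps it mono, by duality, and this is incompatible with
    [f ⊗ f = 0].

    Exactness of the tensor product enters only through rigidity: a functor
    [Z ⊗ -] or [- ⊗ Z] has adjoints given by tensoring with duals
    ([tensl_mono], [tensl_epi], [tensr_mono]). *)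

(** * Isomorphisms *)

Section Isomorphisms.
Variable C : category.

Lemma is_iso_hom (X Y : C) (f : iso X Y) : is_iso f.
Proof. by exists (iso_inv f); rewrite iso_invK iso_homK. Qed.

Lemma is_iso_inv (X Y : C) (f : iso X Y) : is_iso (iso_inv f).
Proof. by exists f; rewrite iso_invK iso_homK. Qed.

Lemma is_iso_comp (X Y Z : C) (g : Mor Y Z) (f : Mor X Y) :
  is_iso g -> is_iso f -> is_iso (g ∘ f).
Proof.
move=> [g' [g'g gg']] [f' [f'f ff']]; exists (f' ∘ g'); split.
  by rewrite compmA -(compmA f') g'g compm1.
by rewrite compmA -(compmA g) ff' compm1.
Qed.

Lemma is_iso_cancell (X Y Z : C) (g : Mor Y Z) (f : Mor X Y) :
  is_iso g -> is_iso (g ∘ f) -> is_iso f.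
Proof.
move=> [g' [g'g gg']] gf_iso.
have -> : f = g' ∘ (g ∘ f) by rewrite compmA g'g comp1m.
by apply: is_iso_comp => //; exists g.
Qed.

Lemma is_iso_tensor (M : monoidal C) (X X' Y Y' : C)
    (f : Mor X X') (g : Mor Y Y') :
  is_iso f -> is_iso g -> is_iso (tensm M f g).
Proof.
move=> [f' [f'f ff']] [g' [g'g gg']].
by exists (tensm M f' g'); rewrite -!tensmM f'f ff' g'g gg' !tensm1.
Qed.

End Isomorphisms.

(** * Zero morphisms and zero objects *)

Section ZeroMorphisms.
Variables (k : fieldType) (C : linear_category k).

Lemma comp0m (X Y Z : C) (f : Mor X Y) : (0 : Mor Y Z) ∘ f = 0.
Proof.
have := @comp_linearl _ C X Y Z (-1) 0 0 f.
by rewrite !scaleN1r !addNr.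
Qed.

Lemma compm0 (X Y Z : C) (f : Mor Y Z) : f ∘ (0 : Mor X Y) = 0.
Proof.
have := @comp_linearr _ C X Y Z (-1) f 0 0.
by rewrite !scaleN1r !addNr.
Qed.

Lemma compmB (X Y Z : C) (f : Mor Y Z) (g h : Mor X Y) :
  f ∘ (g - h) = f ∘ g - f ∘ h.
Proof.
have := @comp_linearr _ C X Y Z (-1) f h g.
by rewrite !scaleN1r [- h + g]addrC => ->; rewrite addrC.
Qed.

Lemma compBm (X Y Z : C) (f g : Mor Y Z) (h : Mor X Y) :
  (f - g) ∘ h = f ∘ h - g ∘ h.
Proof.
have := @comp_linearl _ C X Y Z (-1) g f h.
by rewrite !scaleN1r [- g + f]addrC => ->; rewrite addrC.
Qed.

Lemma compmZ (X Y Z : C) (a : k) (f : Mor Y Z) (g : Mor X Y) :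
  f ∘ (a *: g) = a *: (f ∘ g).
Proof.
have := @comp_linearr _ C X Y Z a f g 0.
by rewrite !addr0 => ->; rewrite compm0 addr0.
Qed.

Lemma monoP (X Y : C) (f : Mor X Y) :
  mono f <-> forall W (g : Mor W X), f ∘ g = 0 -> g = 0.
Proof.
split=> [f_mono W g fg0|f_inj W g h fgh]; first by apply: f_mono; rewrite compm0.
by apply/eqP; rewrite -subr_eq0; apply/eqP/f_inj; rewrite compmB fgh subrr.
Qed.

Lemma epiP (X Y : C) (f : Mor X Y) :
  epi f <-> forall Z (g : Mor Y Z), g ∘ f = 0 -> g = 0.
Proof.
split=> [f_epi W g gf0|f_inj W g h fgh]; first by apply: f_epi; rewrite comp0m.
by apply/eqP; rewrite -subr_eq0; apply/eqP/f_inj; rewrite compBm fgh subrr.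
Qed.

Lemma is_iso_eq0l (X Y Z : C) (f : Mor Y Z) (g : Mor X Y) :
  is_iso f -> f ∘ g = 0 -> g = 0.
Proof. by move=> [f' [f'f _]] fg0; rewrite -[g]comp1m -f'f -compmA fg0 compm0. Qed.

Lemma is_iso_eq0r (X Y Z : C) (f : Mor Y Z) (g : Mor X Y) :
  is_iso g -> f ∘ g = 0 -> f = 0.
Proof. by move=> [g' [_ gg']] fg0; rewrite -[f]compm1 -gg' compmA fg0 comp0m. Qed.

Lemma is_zeroP (X : C) : is_zero X <-> idm X = 0.
Proof.
split=> [[/(_ X) [f [_ f_uniq]] _]|id0].
  by rewrite -(f_uniq (idm X) I) -(f_uniq 0 I).
split=> Y; exists 0; split=> // f _.
  by rewrite -[f]compm1 id0 compm0.
by rewrite -[f]comp1m id0 comp0m.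
Qed.

Lemma kernel_mono (X Y K : C) (f : Mor X Y) (i : Mor K X) :
  is_kernel f i -> mono i.
Proof.
move=> [fi0 i_univ] W g h igh.
have [|u [_ u_uniq]] := i_univ W (i ∘ g); first by rewrite compmA fi0 comp0m.
by rewrite -(u_uniq g) // -(u_uniq h).
Qed.

Lemma kernel_zero_mono (X Y K : C) (f : Mor X Y) (i : Mor K X) :
  is_kernel f i -> is_zero K -> mono f.
Proof.
move=> [_ i_univ] /is_zeroP K0; apply/monoP => W g /i_univ [h [<- _]].
by rewrite -[h]comp1m K0 comp0m compm0.
Qed.

(** Schur: the kernel of a map out of a simple object is zero or everything. *)
Lemma simple_mono (S Y : C) (f : Mor S Y) :
  abelian C -> simple S -> f <> 0 -> mono f.
Proof.
move=> C_ab [_ S_simple] f_neq0.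
have [K [i i_ker]] := ab_kernel C_ab f.
have [K0|i_iso] := S_simple _ i (kernel_mono i_ker).
  exact: kernel_zero_mono i_ker K0.
by case: f_neq0; apply: is_iso_eq0r i_iso _; case: i_ker.
Qed.

Lemma mono_epi_iso (X Y : C) (f : Mor X Y) :
  abelian C -> mono f -> epi f -> is_iso f.
Proof.
move=> C_ab f_mono f_epi; have [Z [g [gf0 f_univ]]] := ab_mono C_ab f_mono.
have g0 : g = 0 by move/epiP: f_epi; apply.
have [|h [fh _]] := f_univ Y (idm Y); first by rewrite g0 comp0m.
by exists h; split=> //; apply: f_mono; rewrite compmA fh comp1m compm1.
Qed.

Lemma simple_iso (X S : C) (f : Mor X S) : is_iso f -> simple S -> simple X.
Proof.
move=> f_iso [S_neq0 S_simple]; have [g [gf fg]] := f_iso; split.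
  move=> /is_zeroP X0; apply/S_neq0/is_zeroP.
  by rewrite -fg -[f]compm1 X0 compm0 comp0m.
move=> Y i i_mono; have [||fi_iso] := S_simple Y (f ∘ i); last 2 first.
- by left.
- by right; apply: is_iso_cancell f_iso fi_iso.
move=> W u v; rewrite -!compmA => /(congr1 (fun h => g ∘ h)).
by rewrite !(compmA g) gf !comp1m => /i_mono.
Qed.

Lemma finite_length_simple_sub (X : C) : finite_length X -> ~ is_zero X ->
  exists (S : C) (i : Mor S X), simple S /\ mono i.
Proof.
elim=> {X} [X //|X' X S i p [i_ker [pi0 p_univ]] S_simple _ IH _].
have [X'0|/IH [T [j [T_simple j_mono]]]] := pselect (is_zero X'); last first.
  exists T, (i ∘ j); split=> // W u v; rewrite -!compmA.
  by move=> /(kernel_mono i_ker) /j_mono.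
have i0 : i = 0 by rewrite -[i]compm1 (is_zeroP _).1 // compm0.
have [|h [hp h_uniq]] := p_univ X (idm X); first by rewrite i0 compm0.
exists X, (idm X); split; last by move=> W u v; rewrite !comp1m.
apply: (@simple_iso _ _ p) => //; exists h; split=> //.
have [|q [_ q_uniq]] := p_univ S p; first exact: pi0.
by rewrite -(q_uniq (idm S)) ?comp1m // -(q_uniq (p ∘ h)) // -compmA hp compm1.
Qed.

End ZeroMorphisms.

(** * Duality and the tensor product *)

Section TensorZero.
Variables (k : fieldType) (C : linear_category k) (M : monoidal C).
Hypothesis M_bilin : tensor_bilinear M.

Local Notation "X ⊠ Y" := (tens M X Y) (at level 37, left associativity).
Local Notation "f ⊗ g" := (tensm M f g) (at level 37, left associativity).
Local Notation "1" := (tunit M).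
Local Notation α := (tassoc M).
Local Notation α' X Y Z := (iso_inv (tassoc M X Y Z)).
Local Notation id := idm.

Lemma tens0m (X X' Y Y' : C) (g : Mor Y Y') : (0 : Mor X X') ⊗ g = 0.
Proof.
have [/(_ (-1) 0 0 g) + _] := M_bilin X X' Y Y'.
by rewrite !scaleN1r !addNr.
Qed.

Lemma tensm0 (X X' Y Y' : C) (f : Mor X X') : f ⊗ (0 : Mor Y Y') = 0.
Proof.
have [_ /(_ (-1) f 0 0)] := M_bilin X X' Y Y'.
by rewrite !scaleN1r !addNr.
Qed.

Lemma tens_unitl_eq0 (X Y : C) (f : Mor X Y) : id 1 ⊗ f = 0 -> f = 0.
Proof.
move=> f0; apply: (is_iso_eq0r (is_iso_hom (tlunit M X))).
by rewrite -tlunit_nat f0 compm0.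
Qed.

Lemma tens_unitr_eq0 (X Y : C) (f : Mor X Y) : f ⊗ id 1 = 0 -> f = 0.
Proof.
move=> f0; apply: (is_iso_eq0r (is_iso_hom (trunit M X))).
by rewrite -trunit_nat f0 compm0.
Qed.

Lemma tensm_id_comp (X Y Y' Y'' : C) (g : Mor Y' Y'') (f : Mor Y Y') :
  id X ⊗ (g ∘ f) = (id X ⊗ g) ∘ (id X ⊗ f).
Proof. by rewrite -tensmM comp1m. Qed.

Lemma tensm_comp_id (X Y Y' Y'' : C) (g : Mor Y' Y'') (f : Mor Y Y') :
  (g ∘ f) ⊗ id X = (g ⊗ id X) ∘ (f ⊗ id X).
Proof. by rewrite -tensmM comp1m. Qed.

Lemma tens_swap (X X' Y Y' : C) (f : Mor X X') (g : Mor Y Y') :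
  (f ⊗ id Y') ∘ (id X ⊗ g) = (id X' ⊗ g) ∘ (f ⊗ id Y).
Proof. by rewrite -!tensmM !comp1m !compm1. Qed.

Lemma tassoc_inv_nat (X X' Y Y' Z Z' : C)
    (f : Mor X X') (g : Mor Y Y') (h : Mor Z Z') :
  α' X' Y' Z' ∘ (f ⊗ (g ⊗ h)) = (f ⊗ g ⊗ h) ∘ α' X Y Z.
Proof.
rewrite -[f ⊗ (g ⊗ h)]compm1 -(iso_homK (α X Y Z)) (compmA (f ⊗ _)).
by rewrite -tassoc_nat !compmA iso_invK comp1m.
Qed.

(** This and the two lemmas below solve the pentagon for the composite of
    associators that occurs when a zigzag is tensored with an object. *)
Lemma pentagon_left (W X Y Z : C) :
  (id W ⊗ α' X Y Z) ∘ α W X (Y ⊠ Z)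
  = α W (X ⊠ Y) Z ∘ (α W X Y ⊗ id Z) ∘ α' (W ⊠ X) Y Z.
Proof.
rewrite -[LHS]compm1 -(iso_homK (α (W ⊠ X) Y Z)) !compmA; congr (_ ∘ _).
rewrite -!compmA pentagon !compmA -tensm_id_comp iso_invK tensm1.
by rewrite comp1m.
Qed.

Lemma pentagon_inv_left (W X Y Z : C) :
  α' W X (Y ⊠ Z) ∘ (id W ⊗ α X Y Z)
  = α (W ⊠ X) Y Z ∘ (α' W X Y ⊗ id Z) ∘ α' W (X ⊠ Y) Z.
Proof.
have p := pentagon M W X Y Z.
have -> : id W ⊗ α X Y Z
    = α W X (Y ⊠ Z) ∘ α (W ⊠ X) Y Z ∘ (α' W X Y ⊗ id Z) ∘ α' W (X ⊠ Y) Z.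
  rewrite p -!(compmA (_ ∘ α W (X ⊠ Y) Z)).
  by rewrite -tensm_comp_id iso_homK tensm1 comp1m -compmA iso_homK compm1.
by rewrite !compmA iso_invK comp1m.
Qed.

Lemma pentagon_right (W X Y Z : C) :
  (α W X Y ⊗ id Z) ∘ α' (W ⊠ X) Y Z
  = α' W (X ⊠ Y) Z ∘ (id W ⊗ α' X Y Z) ∘ α W X (Y ⊠ Z).
Proof. by rewrite -compmA pentagon_left !compmA iso_invK comp1m. Qed.

Section Dual.
Variables (W Z : C) (ev : Mor (W ⊠ Z) 1) (coev : Mor 1 (Z ⊠ W)).
Hypothesis zigzag1 :
  trunit M Z ∘ (id Z ⊗ ev) ∘ α Z W Z ∘ (coev ⊗ id Z) = tlunit M Z.
Hypothesis zigzag2 :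
  tlunit M W ∘ (ev ⊗ id W) ∘ α' W Z W ∘ (id W ⊗ coev) = trunit M W.

(** Up to unitors the two zigzags are identities; the unitors never have to
    be removed, since only invertibility matters in what follows. *)
Lemma zigzag1_iso : is_iso ((id Z ⊗ ev) ∘ α Z W Z ∘ (coev ⊗ id Z)).
Proof.
apply: is_iso_cancell (is_iso_hom (trunit M Z)) _.
by rewrite !compmA zigzag1; apply: is_iso_hom.
Qed.

Lemma zigzag2_iso : is_iso ((ev ⊗ id W) ∘ α' W Z W ∘ (id W ⊗ coev)).
Proof.
apply: is_iso_cancell (is_iso_hom (tlunit M W)) _.
by rewrite !compmA zigzag2; apply: is_iso_hom.
Qed.

(** A morphism [f : Z -> B] is recovered from its name [1 -> B ⊗ W]. *)
Lemma name_eq0 (B : C) (f : Mor Z B) : (f ⊗ id W) ∘ coev = 0 -> f = 0.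
Proof.
move=> f0; apply: (is_iso_eq0r (is_iso_hom (tlunit M Z))).
rewrite -zigzag1 !compmA -trunit_nat -(compmA (trunit M B)) tens_swap.
rewrite compmA -(compmA _ _ (α Z W Z)).
have -> : (f ⊗ id (W ⊠ Z)) ∘ α Z W Z = α B W Z ∘ (f ⊗ id W ⊗ id Z).
  by rewrite tassoc_nat tensm1.
by rewrite -!compmA -tensm_comp_id f0 tens0m !compm0.
Qed.

(** The same for morphisms [f : W -> B] and their names [1 -> Z ⊗ B]. *)
Lemma coname_eq0 (B : C) (f : Mor W B) : (id Z ⊗ f) ∘ coev = 0 -> f = 0.
Proof.
move=> f0; apply: (is_iso_eq0r (is_iso_hom (trunit M W))).
rewrite -zigzag2 !compmA -tlunit_nat -(compmA (tlunit M B)) -tens_swap.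
rewrite compmA -(compmA _ _ (α' W Z W)).
have -> : (id (W ⊠ Z) ⊗ f) ∘ α' W Z W = α' W Z B ∘ (id W ⊗ (id Z ⊗ f)).
  by rewrite tassoc_inv_nat tensm1.
by rewrite -!compmA -tensm_id_comp f0 tensm0 !compm0.
Qed.

(** [Z ⊗ -] is right adjoint to [W ⊗ -], hence preserves monomorphisms. *)
Lemma tensl_mono (A B : C) (f : Mor A B) : mono f -> mono (id Z ⊗ f).
Proof.
move=> /monoP f_inj; apply/monoP => D g fg0.
(* The transpose of [g] under the adjunction is killed by [f]. *)
have gt0 : tlunit M A ∘ (ev ⊗ id A) ∘ α' W Z A ∘ (id W ⊗ g) = 0.
  apply: f_inj; rewrite !compmA -tlunit_nat -(compmA (tlunit M B)) -tens_swap.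
  rewrite compmA -(compmA _ _ (α' W Z A)).
  have -> : (id (W ⊠ Z) ⊗ f) ∘ α' W Z A = α' W Z B ∘ (id W ⊗ (id Z ⊗ f)).
    by rewrite tassoc_inv_nat tensm1.
  by rewrite -!compmA -tensm_id_comp fg0 tensm0 !compm0.
have {}gt0 : (ev ⊗ id A) ∘ α' W Z A ∘ (id W ⊗ g) = 0.
  by apply: (is_iso_eq0l (is_iso_hom (tlunit M A))); rewrite !compmA.
(* [s] is one side of a triangle identity of the adjunction, up to unitors;
   [s ∘ (1 ⊗ g)] factors through [Z ⊗ -] applied to the transpose of [g]. *)
pose s := (id Z ⊗ ((ev ⊗ id A) ∘ α' W Z A)) ∘ α Z W (Z ⊠ A)
            ∘ (coev ⊗ id (Z ⊠ A)).
have s_iso : is_iso s.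
  have -> : s = α Z 1 A
      ∘ (((id Z ⊗ ev) ∘ α Z W Z ∘ (coev ⊗ id Z)) ⊗ id A) ∘ α' 1 Z A.
    rewrite /s tensm_id_comp -(compmA (id Z ⊗ (ev ⊗ id A))) pentagon_left.
    rewrite !compmA -tassoc_nat -!compmA -(tensm1 M Z A) tassoc_inv_nat.
    by rewrite !tensm_comp_id !compmA.
  apply: is_iso_comp (is_iso_inv _); apply: is_iso_comp (is_iso_hom _) _.
  apply: is_iso_tensor zigzag1_iso _.
  by exists (id A); rewrite comp1m.
apply: tens_unitl_eq0; apply: is_iso_eq0l s_iso _.
rewrite /s -(compmA _ (coev ⊗ _)) tens_swap !compmA -(compmA _ (α _ _ _)).
rewrite -(tensm1 M Z W) tassoc_nat !compmA -tensm_id_comp gt0 tensm0.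
by rewrite !comp0m.
Qed.

(** [W ⊗ -] is left adjoint to [Z ⊗ -], hence preserves epimorphisms. *)
Lemma tensl_epi (A B : C) (f : Mor A B) : epi f -> epi (id W ⊗ f).
Proof.
move=> /epiP f_inj; apply/epiP => D g gf0.
have gt0 : (id Z ⊗ g) ∘ α Z W B ∘ (coev ⊗ id B) = 0.
  have lB := is_iso_inv (tlunit M B).
  apply: is_iso_eq0r lB _; apply: f_inj; rewrite -compmA.
  have -> : iso_inv (tlunit M B) ∘ f = (id 1 ⊗ f) ∘ iso_inv (tlunit M A).
    rewrite -[RHS]comp1m -(iso_invK (tlunit M B)) -!compmA; congr (_ ∘ _).
    by rewrite compmA tlunit_nat -compmA iso_homK compm1.
  rewrite compmA -(compmA _ (coev ⊗ _)) tens_swap compmA -(compmA _ (α _ _ _)).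
  rewrite -(tensm1 M Z W) tassoc_nat compmA -tensm_id_comp gf0 tensm0.
  by rewrite !comp0m.
(* [s] is the other triangle identity, up to unitors. *)
pose s := (ev ⊗ id (W ⊠ B)) ∘ α' W Z (W ⊠ B)
            ∘ (id W ⊗ (α Z W B ∘ (coev ⊗ id B))).
have s_iso : is_iso s.
  have -> : s = α 1 W B
      ∘ (((ev ⊗ id W) ∘ α' W Z W ∘ (id W ⊗ coev)) ⊗ id B) ∘ α' W 1 B.
    rewrite /s tensm_id_comp -(compmA (ev ⊗ _)) (compmA (α' _ _ _)).
    rewrite pentagon_inv_left -(compmA _ (α' W (Z ⊠ W) B)) tassoc_inv_nat.
    by rewrite !compmA -(tensm1 M W B) -tassoc_nat !tensm_comp_id !compmA.
  apply: is_iso_comp (is_iso_inv _); apply: is_iso_comp (is_iso_hom _) _.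
  apply: is_iso_tensor zigzag2_iso _.
  by exists (id B); rewrite comp1m.
apply: tens_unitl_eq0; apply: is_iso_eq0r s_iso _.
rewrite /s !compmA -tens_swap -(compmA (ev ⊗ _)).
rewrite -(tensm1 M W Z) -tassoc_inv_nat -!compmA -tensm_id_comp.
by rewrite (compmA _ (α _ _ _)) gt0 tensm0 !compm0.
Qed.

(** [- ⊗ W] is right adjoint to [- ⊗ Z], hence preserves monomorphisms. *)
Lemma tensr_mono (A B : C) (f : Mor A B) : mono f -> mono (f ⊗ id W).
Proof.
move=> /monoP f_inj; apply/monoP => D g fg0.
have gt0 : trunit M A ∘ (id A ⊗ ev) ∘ α A W Z ∘ (g ⊗ id Z) = 0.
  apply: f_inj; rewrite !compmA -trunit_nat -(compmA (trunit M B)) tens_swap.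
  rewrite compmA -(compmA _ _ (α A W Z)).
  have -> : (f ⊗ id (W ⊠ Z)) ∘ α A W Z = α B W Z ∘ (f ⊗ id W ⊗ id Z).
    by rewrite tassoc_nat tensm1.
  by rewrite -!compmA -tensm_comp_id fg0 tens0m !compm0.
have {}gt0 : (id A ⊗ ev) ∘ α A W Z ∘ (g ⊗ id Z) = 0.
  by apply: (is_iso_eq0l (is_iso_hom (trunit M A))); rewrite !compmA.
(* As for [Z ⊗ -], one side of a triangle identity, up to unitors. *)
pose s := (((id A ⊗ ev) ∘ α A W Z) ⊗ id W) ∘ α' (A ⊠ W) Z W
            ∘ (id (A ⊠ W) ⊗ coev).
have s_iso : is_iso s.
  have -> : s = α' A 1 W
      ∘ (id A ⊗ ((ev ⊗ id W) ∘ α' W Z W ∘ (id W ⊗ coev))) ∘ α A W 1.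
    rewrite /s tensm_comp_id -(compmA (id A ⊗ ev ⊗ id W)) pentagon_right.
    rewrite !compmA -tassoc_inv_nat -!compmA -(tensm1 M A W) tassoc_nat.
    by rewrite !tensm_id_comp !compmA.
  apply: is_iso_comp (is_iso_hom _); apply: is_iso_comp (is_iso_inv _) _.
  apply: is_iso_tensor zigzag2_iso.
  by exists (id A); rewrite comp1m.
apply: tens_unitr_eq0; apply: is_iso_eq0l s_iso _.
rewrite /s -(compmA _ (_ ⊗ coev)) -tens_swap !compmA -(compmA _ (α' _ _ _)).
rewrite -(tensm1 M Z W) tassoc_inv_nat !compmA -tensm_comp_id gt0 tens0m.
by rewrite !comp0m.
Qed.

End Dual.
End TensorZero.

(** * The unit object of a tensor category *)

Section TensorCategory.
Variables (k : fieldType) (C : linear_category k) (M : monoidal C).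
Hypothesis C_tensor : tensor_category M.
Hypothesis C_length : forall X : C, finite_length X.

Local Notation "X ⊠ Y" := (tens M X Y) (at level 37, left associativity).
Local Notation "f ⊗ g" := (tensm M f g) (at level 37, left associativity).
Local Notation "1" := (tunit M).
Local Notation id := idm.

Let C_abelian := tc_abelian C_tensor.
Let M_bilin := tc_bilinear C_tensor.

Lemma unit_endo_iso (f : Mor 1 1) : f <> 0 -> is_iso f.
Proof.
have [lam _ lamK] := tc_unit C_tensor; rewrite -(lamK f).
move: (lam f) => a a_neq0; exists (a^-1 *: id 1).
have a0 : a != 0%R by apply: contra_notN a_neq0 => /eqP ->; rewrite scale0r.
by rewrite !compmZ !compm1 !scalerA mulVf // mulfV // scale1r.
Qed.

(** If [S] is simple and [i : S -> 1] is mono, its dual [1 -> S'] is epi;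
    tensoring with [S] gives an epimorphism [S -> S ⊗ S'], which is invertible
    by Schur.  The coevaluation thus becomes a nonzero map [e : 1 -> S], and
    [i ∘ e] is a nonzero, hence invertible, endomorphism of the unit. *)
Lemma simple_sub_unit_split (S : C) (i : Mor S 1) :
  simple S -> mono i -> exists e : Mor 1 S, is_iso (i ∘ e).
Proof.
move=> S_simple i_mono.
have [[S' [ev [coev [zig1 zig2]]]] _] := tc_rigid C_tensor S.
have coev_neq0 : coev <> 0.
  move=> coev0; case: S_simple => + _; apply; apply/is_zeroP.
  by apply: (name_eq0 M_bilin zig1); rewrite coev0 compm0.
(* [i'] is the dual of [i]. *)
pose i' := tlunit M S' ∘ (i ⊗ id S') ∘ coev.
have i'_epi : epi i'.
  apply/epiP => Z f fi'0; apply: (coname_eq0 M_bilin zig2).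
  have [_ [Z' [evZ [coevZ [_ zigZ]]]]] := tc_rigid C_tensor Z.
  have /monoP := tensr_mono M_bilin zigZ i_mono; apply.
  apply: is_iso_eq0l (is_iso_hom (tlunit M Z)) _.
  rewrite (compmA (i ⊗ _)) tens_swap !compmA tlunit_nat.
  by rewrite -[RHS]fi'0 /i' !compmA.
have [_ [S2 [ev2 [coev2 [_ zig2']]]]] := tc_rigid C_tensor S.
pose phi := (id S ⊗ i') ∘ iso_inv (trunit M S).
have phi_epi : epi phi.
  apply/epiP => Z g; rewrite /phi compmA => gphi0.
  have /epiP := tensl_epi M_bilin zig2' i'_epi; apply.
  exact: is_iso_eq0r (is_iso_inv _) gphi0.
have phi_neq0 : phi <> 0.
  move=> phi0; apply: coev_neq0; rewrite -[coev]comp1m.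
  suff -> : id (S ⊠ S') = 0 by rewrite comp0m.
  by have /epiP := phi_epi; apply; rewrite phi0 compm0.
have phi_mono : mono phi := simple_mono C_abelian S_simple phi_neq0.
have [psi [_ phiK]] := mono_epi_iso C_abelian phi_mono phi_epi.
exists (psi ∘ coev); apply: unit_endo_iso => ie0; apply: coev_neq0.
have psi_coev0 : psi ∘ coev = 0 by have /monoP := i_mono; apply.
by rewrite -[coev]comp1m -phiK -compmA psi_coev0 compm0.
Qed.

(** The unit is simple: otherwise the kernel of [h] would contain a simple
    subobject, but no simple subobject of the unit is proper. *)
Lemma unit_mono (Z : C) (h : Mor 1 Z) : h <> 0 -> mono h.
Proof.
move=> h_neq0; have [K [i i_ker]] := ab_kernel C_abelian h.
have [K0|] := pselect (is_zero K); first exact: kernel_zero_mono i_ker K0.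
move=> /(finite_length_simple_sub (C_length K)) [S [j [S_simple j_mono]]].
have [|e ije_iso] := @simple_sub_unit_split S (i ∘ j) S_simple.
  by move=> W u v; rewrite -!compmA => /(kernel_mono i_ker) /j_mono.
case: h_neq0; apply: is_iso_eq0r ije_iso _.
by rewrite !compmA i_ker.1 !comp0m.
Qed.

(** Tensor reducedness at the level of morphisms.  If [f : A -> B] is nonzero,
    so is its name [n : 1 -> B ⊗ A'], which is then mono; so is [B ⊗ n], and
    [(B ⊗ n) ∘ (f ⊗ 1) = f ⊗ n] factors through [f ⊗ f ⊗ A'].
    Working with morphisms instead of objects avoids images. *)
Lemma tens_square_eq0 (A B : C) (f : Mor A B) : f ⊗ f = 0 -> f = 0.
Proof.
move=> ff0; apply: contrapT => f_neq0.
have [[A' [ev [coev [zig1 _]]]] _] := tc_rigid C_tensor A.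
pose n := (f ⊗ id A') ∘ coev.
have n_mono : mono n by apply: unit_mono => /(name_eq0 M_bilin zig1).
have [[B' [evB [coevB [zigB _]]]] _] := tc_rigid C_tensor B.
have /monoP Bn_mono := tensl_mono M_bilin zigB n_mono.
apply/f_neq0/(tens_unitr_eq0 (M := M))/Bn_mono.
rewrite -tensmM comp1m compm1 /n -[f in f ⊗ _]compm1 tensmM.
apply: is_iso_eq0l (is_iso_inv (tassoc M B B A')) _.
by rewrite compmA tassoc_inv_nat ff0 tens0m // !comp0m.
Qed.

End TensorCategory.

(** * Filtered colimits and finitely presented objects *)

(** In a filtered colimit of sets two elements are identified only if they are
    already identified at a finite stage; the map to [bool] recording whether
    a morphism into the diagram dies at a finite stage is a cocone. *)
Lemma fp_leg_eq0 (k : fieldType) (C : linear_category k) (I : small_category)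
    (D : functor I C) (L : C) (c : cocone D L) (X : C) (i : I)
    (g : Mor X (D i)) :
  filtered I -> is_colimit c -> finitely_presented X -> c i ∘ g = 0 ->
  exists (j : I) (u : Mor i j), fmap D u ∘ g = 0.
Proof.
move=> I_filt c_col X_fp cg0; have [_ I_bound I_eq] := I_filt.
pose dies (i : I) : @Mor SET (Mor X (D i)) bool :=
  fun g => `[< exists (j : I) (u : Mor i j), fmap D u ∘ g = 0 >].
have dies_nat i1 i2 (u : Mor i1 i2) :
    (dies i2 : @Mor SET _ _) ∘ fmap (comp_functor (hom_functor X) D) u
    = dies i1.
  apply: funext => h /=; rewrite /dies /hom_map; apply: asbool_equiv_eq; split.
    move=> [j [v vuh0]]; exists j, (v ∘ u).
    by rewrite fmapM -compmA.
  move=> [j [v vh0]]; have [m [[a] [b]]] := I_bound i2 j.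
  have [l [e eab]] := I_eq _ _ (a ∘ u) (b ∘ v).
  exists l, (e ∘ a); rewrite compmA -fmapM -compmA eab.
  by rewrite !fmapM -!compmA vh0 !compm0.
have [h [hE _]] := X_fp I D L c I_filt c_col _ (Cocone dies_nat).
have h_dies j (g' : Mor X (D j)) : h (c j ∘ g') = dies j g'.
  by have := congr1 (fun F => F g') (hE j).
have : dies i g.
  rewrite -h_dies cg0 -(compm0 X (c i)) h_dies; apply/asboolP.
  by exists i, (idm i); rewrite compm0.
by move=> /asboolP.
Qed.

Lemma colimit_zero (k : fieldType) (C : linear_category k) (I : category)
    (D : functor I C) (L : C) (c : cocone D L) :
  is_colimit c -> (forall i, c i = 0) -> is_zero L.
Proof.
move=> c_col c0; apply/is_zeroP; have [h [_ h_uniq]] := c_col L c.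
rewrite -(h_uniq (idm L)) => [|i]; last by rewrite comp1m.
by apply: h_uniq => i; rewrite c0 comp0m.
Qed.

(** * Tensor products of colimits *)

Section TensorAlong.
Variables (k : fieldType) (A : lft_grothendieck k).
Local Notation M := (lft_monoidal A).
Local Notation incl := (fp_incl A).

Let M_bilin : tensor_bilinear M := tc_bilinear (lft_tensor A).1.

Lemma tensor_along_leg (X Y : A) (P : presentation X) (Q : presentation Y)
    (i i' : pr_index P) (u : Mor i i') (j : pr_index Q) :
  col_cocone (colim (outer_diag P Q)) i ∘ col_cocone (colim (inner_diag Q i)) j
  = col_cocone (colim (outer_diag P Q)) i' ∘ outer_leg u j.
Proof.
rewrite -(leg_nat (col_cocone (colim (outer_diag P Q))) u) -compmA.
by congr (_ ∘ _); apply: (col_descE (colim (inner_diag Q i))).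

Qed.

Lemma tensor_along_zero (X Y : A) (P : presentation X) (Q : presentation Y) :
  is_zero X -> is_zero (tensor_along P Q).
Proof.
move=> /is_zeroP X0; apply: (colimit_zero (col_univ (colim (outer_diag P Q)))).
move=> i; apply: (@col_ext _ _ _ (colim (inner_diag Q i))) => j; rewrite comp0m.
have [|i' [u]] := @fp_leg_eq0 _ _ _ (comp_functor incl (pr_diag P)) _ _ _ i
  (idm (sval (pr_diag P i))) (pr_filtered P) (@pr_univ _ _ _ P)
  (svalP (pr_diag P i)).
  by rewrite -[LHS]comp1m X0 comp0m.
rewrite compm1 => u0; rewrite (tensor_along_leg u) /outer_leg.
have -> : fmap (pr_diag P) u = 0 by [].
by rewrite tens0m // !compm0.
Qed.

(** If [X ⊗ X = 0] then, the [A_i ⊗ A_i] being finitely presented, each of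
    them dies at a finite stage: some transition map [f : A_i -> A_l] has
    [f ⊗ f = 0].  Then [f = 0], so that [A_i -> X] is zero for each [i]. *)
Lemma tensor_along_square_zero (X : A) (P : presentation X) :
  is_zero (tensor_along P P) -> is_zero X.
Proof.
move=> /is_zeroP XX0; have [_ P_bound P_eq] := pr_filtered P.
apply: (colimit_zero (@pr_univ _ _ _ P)) => i.
pose Aii := tens M (pr_diag P i) (pr_diag P i).
have [|i' [u]] := @fp_leg_eq0 _ _ _ (outer_diag P P) _ _ _ i
  (col_cocone (colim (inner_diag P i)) i) (pr_filtered P)
  (col_univ (colim (outer_diag P P))) (svalP Aii).
  by rewrite -[LHS]comp1m XX0 comp0m.
have -> : fmap (outer_diag P P) u ∘ col_cocone (colim (inner_diag P i)) i
          = outer_leg u i by exact: (col_descE (colim (inner_diag P i))).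
move=> /(@fp_leg_eq0 _ _ _ (inner_diag P i') _ _ _ i _ (pr_filtered P)
  (col_univ (colim (inner_diag P i'))) (svalP Aii)) [j [v uv0]].
have {}uv0 : tensm M (fmap (pr_diag P) u) (fmap (pr_diag P) v) = 0.
  by rewrite -[fmap _ u]comp1m -[fmap _ v]compm1 tensmM.
(* Make the two transition maps [u] and [v] out of [A_i] equal. *)
have [m [[a] [b]]] := P_bound i' j.
have [l [e eab]] := P_eq _ _ (a ∘ u) (b ∘ v).
have w0 : fmap (pr_diag P) (e ∘ (a ∘ u)) = 0.
  have [M_tensor [_ fp_length _]] := lft_tensor A.
  apply: (tens_square_eq0 M_tensor fp_length).
  by rewrite {2}eab !compmA !(fmapM _ (e ∘ _)) tensmM uv0 compm0.
rewrite -(leg_nat (pr_cocone P) (e ∘ (a ∘ u))).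
have -> : fmap (comp_functor incl (pr_diag P)) (e ∘ (a ∘ u)) = 0 := w0.
exact: compm0.
Qed.

End TensorAlong.

Theorem theorem3p12 (k : closedFieldType) (A : lft_grothendieck k) :
  tensor_reduced A.
Proof.
move=> X; split; first exact: tensor_along_square_zero.
exact: tensor_along_zero.
Qed.
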